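(* Consider the multi-component Curie–Weiss Ising model described in the context, with $\beta>\beta_{cr}$. Then the Glauber dynamics has a mixing time that is exponential in $n$: there is a constant $c>0$ such that $t_{mix}^{(n)}\ge e^{cn}$ for all sufficiently large $n$.
   Context: Fix an integer $m\ge 1$, proportions $p_1,\dots,p_m>0$ with $\sum_i p_i=1$, and a symmetric matrix $\mathbf K=(k_{ij})$ with all $k_{ij}>0$. The parameter $n$ ranges over positive integers with $np_i\in\mathbb N$ for all $i$. The vertex set $V=\{1,\dots,n\}$ is partitioned into blocks $G_1,\dots,G_m$ with $|G_i|=np_i$; for $v\in G_i,w\in G_j$ put $K(v,w)=k_{ij}/n$. On $\Omega=\{-1,+1\}^V$ the Gibbs measure at inverse temperature $\beta$ is $\mu_n(\sigma)\propto\exp\big(\beta\sum_{\{v,w\},v\ne w}K(v,w)\sigma(v)\sigma(w)\big)$. The Glauber dynamics picks at each step a uniformly random vertex $v$ and sets its spin to $\pm1$ with probability $\frac{1\pm\tanh(\beta S^v)}{2}$, $S^v=\sum_{w\ne v}K(v,w)\sigma(w)$. Let $d_n(t)=\max_\sigma\|\mathbb P_\sigma(\sigma_t\in\cdot)-\mu_n\|_{TV}$ and $t_{mix}^{(n)}=\min\{t:d_n(t)\le1/4\}$. Let $\mathbf B=(p_ik_{ij})$, $\mathbf a>0$ its left Perron eigenvector with $\|\mathbf a\|_1=1$, and $\beta_{cr}=(\sum_{i,j}a_ip_ik_{ij})^{-1}$. *)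

(* Defs.v *)
From HB Require Import structures.
From mathcomp Require Import all_boot all_order all_algebra.
From mathcomp Require Import boolp reals.
From mathcomp Require Import sequences exp.
Set Implicit Arguments. Unset Strict Implicit. Unset Printing Implicit Defensive.
Import Order.TTheory GRing.Theory Num.Theory.
Local Open Scope ring_scope.

Section CurieWeiss.
Variable R : realType.

Definition tanhR (x : R) : R := (expR x - expR (- x)) / (expR x + expR (- x)).

Definition spin (b : bool) : R := if b then 1 else -1.

Variables (m : nat) (p : 'I_m -> R) (k : 'I_m -> 'I_m -> R).

(* B = (p_i k_ij); a is a left Perron eigenvector of B normalised in l^1:
   a positive left eigenvector (unique by Perron-Frobenius, B > 0). *)
Definition is_left_perron (a : 'I_m -> R) : Prop :=
  (forall i, 0 < a i) /\ \sum_i a i = 1 /\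
  exists lam : R, forall j, \sum_i a i * (p i * k i j) = lam * a j.

Definition beta_cr (a : 'I_m -> R) : R :=
  (\sum_i \sum_j a i * p i * k i j)^-1.

(* n vertices, g v = the block containing v *)
Variables (n : nat) (g : 'I_n -> 'I_m) (beta : R).

Definition config := {ffun 'I_n -> bool}.

Definition Kint (v w : 'I_n) : R := k (g v) (g w) / n%:R.

Definition energy (s : config) : R :=
  \sum_(v : 'I_n) \sum_(w : 'I_n | (v < w)%N) Kint v w * spin (s v) * spin (s w).

Definition partition_fn : R := \sum_(s : config) expR (beta * energy s).

Definition gibbs (s : config) : R := expR (beta * energy s) / partition_fn.

Definition locfield (s : config) (v : 'I_n) : R :=
  \sum_(w : 'I_n | w != v) Kint v w * spin (s w).

Definition glauberP (s t : config) : R :=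
  n%:R^-1 * \sum_(v : 'I_n)
    (if [forall w, (w != v) ==> (t w == s w)]
     then (1 + spin (t v) * tanhR (beta * locfield s v)) / 2 else 0).

Fixpoint distr (t : nat) (s : config) : config -> R :=
  match t with
  | 0 => fun u => if u == s then 1 else 0
  | t'.+1 => fun u => \sum_(r : config) distr t' s r * glauberP r u
  end.

Definition tv (mu nu : config -> R) : R := 2^-1 * \sum_(u : config) `|mu u - nu u|.

Definition dmix (t : nat) : R := \big[Num.max/0]_(s : config) tv (distr t s) gibbs.

(* t_mix = min { t : d(t) <= 1/4 } (0 if no such t, which does not happen) *)
Definition tmix : nat :=
  match pselect (exists t, dmix t <= 4^-1) with
  | left h => @ex_minn (fun t => dmix t <= 4^-1) h
  | right _ => 0%N
  end.

End CurieWeiss.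

(* Main.v *)
(* Let M be the total magnetisation.  One Glauber step changes M by at most 2,
   so the chain leaves {M > 0} only through E = {|M| <= 2}.  Starting from the
   Gibbs measure restricted to {M > 0}, the probability of having left by time t
   is at most t mu(E) / mu(M > 0); by spin-flip symmetry mixing needs this to be
   bounded below, so t_mix >= 1 / (16 mu(E)).

   Write M_i for the magnetisation of block i and split E according to the size
   of N = sum_i |M_i|.  If N^2 >= d n^2, then since the M_i nearly cancel,
   reversing every block with M_i < 0 raises the energy by order n, and this map
   is at most 2^m-to-one.  If N^2 < d n^2, the energy is at most a small multiple
   of n, so these configurations weigh at most 2^n e^{small n}.  Against this,
   Z >= 2^n e^{c1 n - C1}: apply Jensen's inequality to the product measure with
   mean eps a_i in block i; the exponent is
   (n eps^2 / 2) (sum_i p_i a_i^2) (beta lambda - 1 - eps) + O(1), where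
   lambda = 1 / beta_cr is the Perron eigenvalue. *)
Require Import Defs.
From HB Require Import structures.
From mathcomp Require Import classical_sets topology normedtype derive realfun.
From mathcomp Require Import all_boot all_order all_algebra.
From mathcomp Require Import boolp reals.
From mathcomp Require Import sequences exp.
From mathcomp Require Import ring lra.
Set Implicit Arguments. Unset Strict Implicit. Unset Printing Implicit Defensive.
Import Order.TTheory GRing.Theory Num.Theory.
Import numFieldNormedType.Exports.
Local Open Scope ring_scope.

(** * Finite Markov chains *)

Section FiniteMarkovChain.
Variables (R : realType) (T : finType) (P : T -> T -> R).

(** The recursion has the shape of [distr], so that [distrE] holds by conversion. *)
Fixpoint kpow (t : nat) (s : T) : T -> R :=
  match t with
  | 0 => fun u => if u == s then 1 else 0
  | t'.+1 => fun u => \sum_(r : T) kpow t' s r * P r u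
  end.

Lemma kpowD t t' s u : kpow (t + t') s u = \sum_r kpow t s r * kpow t' r u.
Proof.
elim: t' u => [|t' IH] u.
  rewrite addn0 (bigD1 u) //= eqxx mulr1 big1 ?addr0 // => r.
  by rewrite eq_sym => /negbTE ->; rewrite mulr0.
rewrite addnS /=.
under eq_bigr => r _ do rewrite IH mulr_suml.
rewrite exchange_big /=; apply: eq_bigr => r _.
by rewrite mulr_sumr; apply: eq_bigr => q _; rewrite mulrA.
Qed.

Hypothesis P_ge0 : forall s u, 0 <= P s u.

Lemma kpow_ge0 t s u : 0 <= kpow t s u.
Proof.
elim: t u => [|t IH] u /=; first by case: ifP.
by apply: sumr_ge0 => r _; rewrite mulr_ge0.
Qed.

Hypothesis P_sum1 : forall s, \sum_u P s u = 1.

Lemma kpow_sum1 t s : \sum_u kpow t s u = 1.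
Proof.
elim: t => [|t IH] /=.
  rewrite (bigD1 s) //= eqxx big1 ?addr0 // => r.
  by move=> /negbTE ->.
rewrite exchange_big /= -[RHS]IH; apply: eq_bigr => r _.
by rewrite -mulr_sumr P_sum1 mulr1.
Qed.

Variable pi : T -> R.
Hypothesis pi_ge0 : forall s, 0 <= pi s.
Hypothesis pi_stat : forall u, \sum_s pi s * P s u = pi u.

Lemma kpow_stat t u : \sum_s pi s * kpow t s u = pi u.
Proof.
elim: t u => [|t IH] u /=.
  rewrite (bigD1 u) //= eqxx mulr1 big1 ?addr0 // => r.
  by rewrite eq_sym => /negbTE ->; rewrite mulr0.
under eq_bigr => s _ do rewrite mulr_sumr.
rewrite exchange_big /= -[RHS]pi_stat; apply: eq_bigr => r _.
by rewrite -(IH r) mulr_suml; apply: eq_bigr => s _; rewrite mulrA.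
Qed.

(* Started from [pi] restricted to [A], the chain has law dominated by [pi] at
   every time, so each step moves at most the stationary flow across the cut. *)
Lemma escape_le (A : pred T) t :
  \sum_(s | A s) pi s * (\sum_(u | ~~ A u) kpow t s u) <=
  t%:R * \sum_(s | A s) pi s * (\sum_(u | ~~ A u) P s u).
Proof.
set F := \sum_(s | A s) pi s * (\sum_(u | ~~ A u) P s u).
(* The law at time [t] of the chain started from [pi] restricted to [A], without normalisation. *)
pose rho t u := \sum_(s | A s) pi s * kpow t s u.
have rho_ge0 t' u : 0 <= rho t' u.
  by apply: sumr_ge0 => s _; rewrite mulr_ge0 ?kpow_ge0.
have rho_le t' u : rho t' u <= pi u.
  rewrite -[leRHS](kpow_stat t') [leRHS](bigID A) /= lerDl.
  by apply: sumr_ge0 => s _; rewrite mulr_ge0 ?kpow_ge0.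
have rhoS t' u : rho t'.+1 u = \sum_r rho t' r * P r u.
  rewrite /rho /=; under eq_bigr => s _ do rewrite mulr_sumr.
  rewrite exchange_big /=; apply: eq_bigr => r _.
  by rewrite mulr_suml; apply: eq_bigr => s _; rewrite mulrA.
have escE t' : \sum_(s | A s) pi s * (\sum_(u | ~~ A u) kpow t' s u)
    = \sum_(u | ~~ A u) rho t' u.
  rewrite /rho exchange_big /=; apply: eq_bigr => s _.
  by rewrite mulr_sumr.
rewrite escE; elim: t => [|t IH].
  rewrite mul0r /rho big1 // => u nAu; rewrite big1 // => s As /=.
  by case: eqP => [us|_]; [rewrite us As in nAu | rewrite mulr0].
under eq_bigr => u _ do rewrite rhoS.
(* Mass outside [A] after [t+1] steps was outside after [t] steps, which is the induction
   hypothesis, or crosses in the last step, which costs at most [F] because [rho <= pi]. *)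
rewrite exchange_big /= (bigID A) /= -natr1 mulrDl mul1r addrC.
apply: lerD.
  apply: le_trans IH; apply: ler_sum => r _; rewrite -mulr_sumr.
  rewrite ler_piMr // -[leRHS](P_sum1 r) [leRHS](bigID A) /= lerDr.
  by apply: sumr_ge0.
apply: ler_sum => r _; rewrite -mulr_sumr ler_wpM2r //.
by apply: sumr_ge0.
Qed.

(* Doeblin: as [d] sums to 0, the constant part [alpha] of [Q] does not contribute. *)
Lemma contraction (Q : T -> T -> R) (alpha : R) (d : T -> R) :
  (forall r u, alpha <= Q r u) -> (forall r, \sum_u Q r u = 1) ->
  \sum_r d r = 0 ->
  \sum_u `|\sum_r d r * Q r u| <= (1 - #|T|%:R * alpha) * \sum_r `|d r|.
Proof.
move=> Qge Q1 d0.
have step u : `|\sum_r d r * Q r u| <= \sum_r `|d r| * (Q r u - alpha).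
  have -> : \sum_r d r * Q r u = \sum_r d r * (Q r u - alpha).
    under [RHS]eq_bigr => r _ do rewrite mulrBr.
    by rewrite big_split /= sumrN -mulr_suml d0 mul0r subr0.
  apply: le_trans (ler_norm_sum _ _ _) _; apply: ler_sum => r _.
  by rewrite normrM [`|Q r u - alpha|]ger0_norm // subr_ge0.
apply: le_trans (ler_sum _ (fun u _ => step u)) _.
rewrite exchange_big /= mulr_sumr; apply: ler_sum => r _.
by rewrite -mulr_sumr big_split /= Q1 sumr_const mulNrn mulr_natl mulrC.
Qed.

Hypothesis pi_sum1 : \sum_s pi s = 1.

(** Serves to show that the minimum defining [tmix] exists. Positivity of the [t0]-step kernel gives
    a uniform lower bound [alpha], so every [t0] steps contract the l^1 distance to [pi] by the
    factor [q]. *)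
Lemma kpow_cvg (t0 : nat) (eps : R) :
  (forall s u, 0 < kpow t0 s u) -> 0 < eps ->
  exists t, forall s, \sum_u `|kpow t s u - pi u| <= eps.
Proof.
move=> Qpos eps0.
pose alpha := \big[Num.min/1]_(x : T * T) kpow t0 x.1 x.2.
have alpha_gt0 : 0 < alpha.
  by apply: lt_bigmin => // x _.
have alpha_le s u : alpha <= kpow t0 s u by apply: (bigmin_le_cond _ (j := (s, u))).
set q := 1 - #|T|%:R * alpha.
have card_gt0 : (0 < #|T|)%N.
  apply/card_gt0P; case: (pickP (fun _ : T => true)) => [s _|T0]; first by exists s.
  by move: pi_sum1; rewrite big_pred0 // => /eqP; rewrite eq_sym oner_eq0.
have [s0 _] := card_gt0P card_gt0.
have q_ge0 : 0 <= q.
  rewrite subr_ge0 mulr_natl -sumr_const -(kpow_sum1 t0 s0).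
  exact: ler_sum.
set gam := #|T|%:R * alpha.
have gam_gt0 : 0 < gam by rewrite mulr_gt0 ?ltr0n.
have geom j s : \sum_u `|kpow (j * t0) s u - pi u| <= q ^+ j * 2.
  elim: j s => [|j IH] s.
    rewrite mul0n expr0 mul1r.
    apply: le_trans (ler_sum _ (fun u _ => ler_normB _ _)) _.
    rewrite big_split /= -[2]/(1 + 1) lerD //.
      rewrite (eq_bigr (kpow 0 s)) ?kpow_sum1 // => u _.
      by rewrite ger0_norm // (kpow_ge0 0).
    by rewrite (eq_bigr pi) ?pi_sum1 // => u _; rewrite ger0_norm.
  have -> : \sum_u `|kpow (j.+1 * t0) s u - pi u| =
      \sum_u `|\sum_r (kpow (j * t0) s r - pi r) * kpow t0 r u|.
    apply: eq_bigr => u _; congr `|_|.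
    rewrite mulSn addnC kpowD -(kpow_stat t0 u) -sumrB.
    by apply: eq_bigr => r _; rewrite mulrBl.
  rewrite exprS -mulrA.
  apply: le_trans (contraction alpha_le (kpow_sum1 t0) _) _.
    by rewrite sumrB kpow_sum1 pi_sum1 subrr.
  by rewrite ler_wpM2l.
(* For this [j], [expR (j gam) >= 1 + j gam >= 2 / eps], while [q ^+ j <= expR (- j gam)]. *)
have [j jP] : exists j : nat, 2 / (gam * eps) <= j%:R.
  exists (Num.bound (2 / (gam * eps))).
  apply/ltW/archi_boundP; apply: divr_ge0 => //.
  by rewrite mulr_ge0 // ltW.
exists (j * t0)%N => s; apply: le_trans (geom j s) _.
have qle : q <= expR (- gam) by apply: le_trans (expR_ge1Dx _).
have : q ^+ j <= expR (j%:R * - gam).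
  by rewrite expRM_natl; apply: lerXn2r => //; rewrite nnegrE ?expR_ge0.
rewrite mulrN expRN => qj.
have h1 : 2 / eps <= expR (j%:R * gam).
  apply: le_trans (expR_ge1Dx _); rewrite ler_wpDl //.
  have -> : 2 / eps = 2 / (gam * eps) * gam by field; rewrite !gt_eqF.
  by rewrite ler_wpM2r // ltW.
apply: le_trans (ler_wpM2r _ qj) _ => //.
rewrite mulrC ler_pdivrMr ?expR_gt0 // mulrC.
by rewrite ler_pdivrMr in h1.
Qed.

End FiniteMarkovChain.

(** As the total masses agree, the differences on [B] and on its complement are opposite, and each
    is bounded by its own share of the l^1 distance. *)
Lemma sum_norm_ge (R : realType) (T : finType) (mu nu : T -> R) (B : pred T) :
  \sum_s mu s = \sum_s nu s ->
  \sum_(s | B s) nu s - \sum_(s | B s) mu s <= 2^-1 * \sum_s `|mu s - nu s|.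
Proof.
move=> e; rewrite (bigID B) /= in e; rewrite [RHS](bigID B) /= in e.
have h1 : \sum_(s | B s) nu s - \sum_(s | B s) mu s <= \sum_(s | B s) `|mu s - nu s|.
  by rewrite -sumrB; apply: ler_sum => s _; rewrite distrC ler_norm.
have h2 : \sum_(s | ~~ B s) mu s - \sum_(s | ~~ B s) nu s
    <= \sum_(s | ~~ B s) `|mu s - nu s|.
  by rewrite -sumrB; apply: ler_sum => s _; rewrite ler_norm.
rewrite [\sum_s `|_|](bigID B) /=; lra.
Qed.

(** * The Glauber chain *)

Lemma sum_pairs (R : realType) (n : nat) (K : 'I_n -> 'I_n -> R) (x : 'I_n -> R) :
  (forall v w, K v w = K w v) ->
  \sum_(v : 'I_n) \sum_(w : 'I_n | (v < w)%N) K v w * x v * x w =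
  2^-1 * \sum_v \sum_(w | w != v) K v w * x v * x w.
Proof.
move=> Ksym; set S := LHS.
have -> : \sum_v \sum_(w | w != v) K v w * x v * x w = S + S; last by field.
have eqS : S = \sum_(v : 'I_n) \sum_(w : 'I_n | (w < v)%N) K v w * x v * x w.
  rewrite /S (exchange_big_dep xpredT) //=; apply: eq_bigr => v _.
  by apply: eq_bigr => w _; rewrite Ksym mulrAC.
rewrite {2}eqS -big_split /=; apply: eq_bigr => v _.
rewrite (bigID (fun w : 'I_n => (v < w)%N)) /=; congr (_ + _); apply: eq_bigl => w.
  by rewrite -(inj_eq val_inj) /=; case: ltngtP.
by rewrite -(inj_eq val_inj) /=; case: ltngtP.
Qed.

Section Glauber.
Variables (R : realType) (m : nat) (k : 'I_m -> 'I_m -> R).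
Variables (n : nat) (g : 'I_n -> 'I_m) (beta : R).
Hypothesis k_sym : forall i j, k i j = k j i.

Let K := Kint k g.
Let P := glauberP k g beta.
Let pi := gibbs k g beta.

Definition magn (s : config n) : R := \sum_v spin R (s v).

Definition upd (s : config n) (v : 'I_n) (b : bool) : config n :=
  [ffun w => if w == v then b else s w].

(** This is the guard of [glauberP] verbatim, so that it can be folded. *)
Definition agree_off (v : 'I_n) (s t : config n) :=
  [forall w, (w != v) ==> (t w == s w)].

Lemma agree_offP (v : 'I_n) (s t : config n) :
  reflect (forall w, w != v -> t w = s w) (agree_off v s t).
Proof.
apply: (iffP forallP) => h w; last by apply/implyP => /h ->.
by move=> wv; apply/eqP; move: (h w); rewrite wv.
Qed.

Lemma agree_off_sym (v : 'I_n) (s t : config n) : agree_off v s t = agree_off v t s.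
Proof. by apply/agree_offP/agree_offP => h w /h. Qed.

Lemma agree_off_upd (v : 'I_n) (s t : config n) : agree_off v s t = (t == upd s v (t v)).
Proof.
apply/agree_offP/eqP => [h|->] => [|w wv].
  by apply/ffunP => w; rewrite ffunE; case: eqP => [->|/eqP /h].
by rewrite ffunE (negbTE wv).
Qed.

Lemma sum_agree_off v s (F : config n -> R) :
  \sum_(t | agree_off v s t) F t = F (upd s v true) + F (upd s v false).
Proof.
have updv b : upd s v b v = b by rewrite ffunE eqxx.
rewrite (bigD1 (upd s v true)) /=; last by rewrite agree_off_upd updv.
rewrite (bigD1 (upd s v false)) /=; last first.
  rewrite agree_off_upd updv eqxx /=; apply/eqP => /ffunP /(_ v).
  by rewrite !updv.
rewrite big1 ?addr0 // => t; rewrite agree_off_upd.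
by case: (t v) => /andP[/andP[/eqP -> /eqP ne1 /eqP ne2]].
Qed.

Lemma K_sym v w : K v w = K w v.
Proof. by rewrite /K /Kint k_sym. Qed.

Lemma locfield_agree v s t : agree_off v s t -> locfield k g t v = locfield k g s v.
Proof.
by move/agree_offP => h; rewrite /locfield; apply: eq_bigr => w /h ->.
Qed.

Lemma energy_agree v s t : agree_off v s t ->
  energy k g t - energy k g s = (spin R (t v) - spin R (s v)) * locfield k g s v.
Proof.
(* The pairs avoiding [v], whose energy an update at [v] leaves unchanged; the half is for ordered
   pairs. *)
move=> st; pose rest u := 2^-1 *
  \sum_(x | x != v) \sum_(w | (w != x) && (w != v)) K x w * spin R (u x) * spin R (u w).
suff energyE u : energy k g u = spin R (u v) * locfield k g u v + rest u.
  have restE : rest t = rest s.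
    rewrite /rest; congr (_ * _); apply: eq_bigr => x xv; apply: eq_bigr => w /andP[_ wv].
    by move/agree_offP : st => h; rewrite !h.
  by rewrite !energyE (locfield_agree st) restE; ring.
rewrite /energy (sum_pairs _ K_sym) (bigD1 v) //=.
rewrite [X in _ + X](eq_bigr (fun x => K x v * spin R (u x) * spin R (u v) +
  \sum_(w | (w != x) && (w != v)) K x w * spin R (u x) * spin R (u w))); last first.
  by move=> x xv; rewrite (bigD1 v) //= eq_sym.
rewrite big_split /= /rest.
set r := \sum_(i | _) \sum_(w | _) _.
have -> : \sum_(w | w != v) K v w * spin R (u v) * spin R (u w) =
    spin R (u v) * locfield k g u v.
  by rewrite mulr_sumr; apply: eq_bigr => w _; rewrite mulrCA mulrA.
have -> : \sum_(x | x != v) K x v * spin R (u x) * spin R (u v) =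
    spin R (u v) * locfield k g u v.
  by rewrite mulr_sumr; apply: eq_bigr => w _; rewrite K_sym mulrC.
by field.
Qed.

(** Heat-bath form: the denominator does not depend on [b], so detailed balance becomes an identity
    between exponents. *)
Lemma glauber_rateE b (x : R) :
  (1 + spin R b * tanhR x) / 2 = expR (spin R b * x) / (expR x + expR (- x)).
Proof.
have h : expR x + expR (- x) != 0 by rewrite gt_eqF // addr_gt0 ?expR_gt0.
by rewrite /tanhR; case: b; rewrite /spin ?mul1r ?mulN1r; field.
Qed.

Lemma glauber_rate_gt0 b (x : R) : 0 < (1 + spin R b * tanhR x) / 2.
Proof. by rewrite glauber_rateE divr_gt0 ?addr_gt0 ?expR_gt0. Qed.

Lemma glauberP_ge0 s t : 0 <= P s t.
Proof.
rewrite mulr_ge0 ?invr_ge0 //; apply: sumr_ge0 => v _; case: ifP => // _.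
exact/ltW/glauber_rate_gt0.
Qed.

Lemma glauberP_sum1 s : (0 < n)%N -> \sum_t P s t = 1.
Proof.
move=> n0; rewrite -mulr_sumr exchange_big /=.
rewrite (eq_bigr (fun=> 1)).
  by rewrite sumr_const card_ord mulVf // pnatr_eq0 -lt0n.
move=> v _; rewrite -big_mkcond sum_agree_off !ffunE eqxx /spin.
by field.
Qed.

Lemma partition_fn_gt0 : 0 < partition_fn k g beta.
Proof.
rewrite /partition_fn (bigD1 [ffun=> true]) //=.
by apply: ltr_wpDr; [apply: sumr_ge0 => s _; rewrite expR_ge0 | rewrite expR_gt0].
Qed.

Lemma gibbs_ge0 s : 0 <= pi s.
Proof. by rewrite divr_ge0 ?expR_ge0 // ltW ?partition_fn_gt0. Qed.

Lemma gibbs_sum1 : \sum_s pi s = 1.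
Proof. by rewrite -mulr_suml mulfV // gt_eqF ?partition_fn_gt0. Qed.

(** Balance holds separately for each updated vertex [v]: both configurations have the same local
    field at [v], and the ratio of the rates matches the energy difference. *)
Lemma detailed_balance s t : pi s * P s t = pi t * P t s.
Proof.
have swap (a z b S : R) : a * z * (b * S) = z * b * (a * S) by ring.
rewrite /pi /gibbs /P /glauberP [LHS]swap [RHS]swap.
congr (_ * _); rewrite [LHS]mulr_sumr [RHS]mulr_sumr; apply: eq_bigr => v _.
rewrite -!/(agree_off v _ _) agree_off_sym; case: ifP => [st|_]; last by rewrite !mulr0.
have e := energy_agree st; rewrite (locfield_agree st).
rewrite !glauber_rateE !mulrA -!expRD; congr (expR _ / _).
have -> : energy k g s = energy k g t + (spin R (s v) - spin R (t v)) * locfield k g t v.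
  by rewrite -e addrC subrK.
by ring.
Qed.

Lemma gibbs_stationary u : (0 < n)%N -> \sum_s pi s * P s u = pi u.
Proof.
move=> n0; under eq_bigr => s _ do rewrite detailed_balance.
by rewrite -mulr_sumr glauberP_sum1 // mulr1.
Qed.

Lemma distrE t s u : distr k g beta t s u = kpow P t s u.
Proof. by []. Qed.

Lemma glauberP_upd_gt0 u v b : (0 < n)%N -> 0 < P (upd u v b) u.
Proof.
move=> n0; rewrite mulr_gt0 ?invr_gt0 ?ltr0n // (bigD1 v) //= ltr_wpDr //.
  apply: sumr_ge0 => w _; case: ifP => // _; exact/ltW/glauber_rate_gt0.
case: ifP => [_|/negbT/forallP[] w]; first exact: glauber_rate_gt0.
by apply/implyP => /negbTE wv; rewrite ffunE wv.
Qed.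

(** The last step comes from [u] with one disagreeing spin reset to that of [s]; once nothing
    disagrees, steps that change no spin use up the remaining time. *)
Lemma glauber_kpow_gt0 j (s u : config n) : (0 < n)%N -> (#|[set v | s v != u v]| <= j)%N ->
  0 < kpow P j s u.
Proof.
move=> n0; elim: j u => [|j IH] u.
  rewrite leqn0 cards_eq0 => /eqP/setP e /=.
  case: eqP => // [[]]; apply/ffunP => v; move: (e v).
  by rewrite !inE => /negbFE/eqP.
move=> hd.
have [v hv] : exists v, (#|[set w | s w != upd u v (s v) w]| <= j)%N.
  case: (pickP (fun v => s v != u v)) => [v sv|su].
    exists v; rewrite -ltnS; apply: leq_trans hd.
    apply: proper_card; apply/properP; split.
      by apply/subsetP => w; rewrite !inE ffunE; case: (w =P _) => // ->; rewrite eqxx.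
    by exists v; rewrite !inE ?ffunE ?eqxx.
  exists (Ordinal n0); rewrite (_ : [set _ | _] = set0) ?cards0 //.
  apply/setP => w; rewrite !inE ffunE; case: (w =P _) => [->|_]; first by rewrite eqxx.
  exact: su.
rewrite /= (bigD1 (upd u v (s v))) //= ltr_wpDr //.
  by apply: sumr_ge0 => r _; rewrite mulr_ge0 ?glauberP_ge0 // (kpow_ge0 glauberP_ge0).
by rewrite mulr_gt0 ?glauberP_upd_gt0 // IH.
Qed.

(** Rules out the default value 0 in [tmix]. Any two configurations differ in at most [n] vertices,
    so [t0 = n] works; l^1 distance 1/2 is total variation 1/4. *)
Lemma dmix_tmix : (0 < n)%N -> dmix k g beta (tmix k g beta) <= 4^-1.
Proof.
move=> n0; rewrite /tmix; case: pselect => [h|[]]; first by case: ex_minnP.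
have [||t tP] := kpow_cvg glauberP_ge0 (glauberP_sum1^~ n0) gibbs_ge0
  (gibbs_stationary^~ n0) gibbs_sum1 (t0 := n) (eps := 2^-1).
- by move=> s u; apply: glauber_kpow_gt0 => //; rewrite -[leqRHS]card_ord max_card.
- by rewrite invr_gt0 ltr0n.
exists t; apply/bigmax_leP; split=> [|s _]; rewrite ?invr_ge0 ?ler0n // /tv.
under eq_bigr => u _ do rewrite distrE.
by have := tP s; rewrite /pi; lra.
Qed.

Lemma magn_agree v s t : agree_off v s t -> magn s <= magn t + 2.
Proof.
move/agree_offP => h; rewrite /magn (bigD1 v) //= [in leRHS](bigD1 v) //=.
rewrite [X in _ <= _ + X + _](eq_bigr (fun w => spin R (s w))); last first.
  by move=> w /h ->.
by rewrite addrAC lerD2r /spin; case: (s v); case: (t v); lra.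
Qed.

(** From [magn s > 2] no single update reaches [magn u <= 0]; from the other starting points the
    exit probability is bounded by 1. *)
Lemma magn_flow : (0 < n)%N ->
  \sum_(s | 0 < magn s) pi s * (\sum_(u | ~~ (0 < magn u)) P s u) <=
  \sum_(s | `|magn s| <= 2) pi s.
Proof.
move=> n0; rewrite (bigID (fun s => `|magn s| <= 2)) /=.
rewrite [X in _ + X]big1 ?addr0.
  rewrite [leRHS](bigID (fun s => 0 < magn s)) /=.
  apply: ler_wpDr; first by apply: sumr_ge0 => s _; exact: gibbs_ge0.
  under eq_bigl => s do rewrite andbC.
  apply: ler_sum => s _; rewrite ler_piMr ?gibbs_ge0 //.
  rewrite -[leRHS](glauberP_sum1 s n0) [leRHS](bigID (fun u => 0 < magn u)) /= lerDr.
  by apply: sumr_ge0 => u _; exact: glauberP_ge0.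
move=> s /andP[ms]; rewrite gtr0_norm // -ltNge => m2.
rewrite big1 ?mulr0 // => u; rewrite -leNgt => mu.
rewrite /P /glauberP big1 ?mulr0 // => v _; case: ifP => // /magn_agree; lra.
Qed.

(** [e] marks the blocks to reverse: all of them for the global spin flip, those of negative
    magnetisation for the energy comparison. *)
Definition flip (e : {ffun 'I_m -> bool}) (s : config n) : config n :=
  [ffun v => e (g v) (+) s v].

Lemma flipK e : involutive (flip e).
Proof. by move=> s; apply/ffunP => v; rewrite !ffunE addbA addbb. Qed.

(** The global spin flip preserves the Gibbs measure and negates the magnetisation. *)
Lemma gibbs_magn_split :
  2 * \sum_(s | 0 < magn s) pi s + \sum_(s | magn s == 0) pi s = 1.
Proof.
pose F := flip [ffun=> true].
have magnF s : magn (F s) = - magn s.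
  by rewrite /magn -sumrN; apply: eq_bigr => v _; rewrite !ffunE; case: (s v); rewrite /spin ?opprK.
have piF s : pi (F s) = pi s.
  rewrite /pi /gibbs; congr (expR (_ * _) / _).
  apply: eq_bigr => v _; apply: eq_bigr => w _; rewrite !ffunE.
  by rewrite /spin; case: (s v); case: (s w) => /=; ring.
have e : \sum_(s | magn s < 0) pi s = \sum_(s | 0 < magn s) pi s.
  rewrite (reindex_inj (inv_inj (flipK [ffun=> true]))) /=.
  by apply: eq_big => [s|s _]; [rewrite magnF oppr_lt0|exact: piF].
rewrite -[RHS]gibbs_sum1 [RHS](bigID (fun s => 0 < magn s)) /=.
rewrite [X in _ = _ + X](bigID (fun s => magn s < 0)) /=.
rewrite mulr_natl mulr2n -addrA; congr (_ + (_ + _)).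
  by rewrite -e; apply: eq_bigl => s; case: ltgtP.
by apply: eq_bigl => s; case: ltgtP.
Qed.

(** By symmetry [A] has mass between 1/4 and 1/2. At time [tmix] every start puts mass at least 1/2
    - 1/4 outside [A], so the escaped mass is at least 1/4 times 1/4, and [escape_le] bounds it
    above. *)
Lemma tmix_bottleneck : (0 < n)%N -> \sum_(s | `|magn s| <= 2) pi s <= 2^-1 ->
  16^-1 <= (tmix k g beta)%:R * \sum_(s | `|magn s| <= 2) pi s.
Proof.
move=> n0; set D := \sum_(s | _) _ => D2; set t := tmix k g beta.
pose A := fun s => 0 < magn s.
have pi0 : \sum_(s | magn s == 0) pi s <= D.
  rewrite /D [leRHS](bigID (fun s => magn s == 0)) /=.
  rewrite [X in _ <= X + _](eq_bigl (fun s => magn s == 0)); last first.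
    by move=> s; case: eqP => [->|_]; rewrite ?andbF // normr0 ler0n.
  by rewrite lerDl; apply: sumr_ge0 => s _; exact: gibbs_ge0.
have pi0_ge0 : 0 <= \sum_(s | magn s == 0) pi s.
  by apply: sumr_ge0 => s _; exact: gibbs_ge0.
have half := gibbs_magn_split.
have piAc : \sum_(s | ~~ A s) pi s = 1 - \sum_(s | A s) pi s.
  by rewrite -[in RHS]gibbs_sum1 [in RHS](bigID A) /= [in RHS]addrC addrK.
have esc s : 4^-1 <= \sum_(u | ~~ A u) kpow P t s u.
  have tvs : tv (distr k g beta t s) pi <= 4^-1.
    apply: le_trans (dmix_tmix n0).
    exact: (le_bigmax _ (fun s => tv (distr k g beta t s) pi)).
  have := sum_norm_ge (mu := kpow P t s) (nu := pi) (fun u => ~~ A u).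
  rewrite (kpow_sum1 (glauberP_sum1^~ n0)) gibbs_sum1 => /(_ erefl).
  move: tvs; rewrite /tv; under eq_bigr => u _ do rewrite distrE.
  rewrite piAc /A; lra.
have := escape_le glauberP_ge0 (glauberP_sum1^~ n0) gibbs_ge0
  (gibbs_stationary^~ n0) A t.
move=> /le_trans /(_ (ler_wpM2l _ (magn_flow n0))) => /(_ (ler0n _ _)).
apply: le_trans.
apply: (@le_trans _ _ (\sum_(s | A s) pi s * 4^-1)); last first.
  by apply: ler_sum => s _; rewrite ler_wpM2l ?gibbs_ge0.
rewrite -mulr_suml /A; lra.
Qed.

End Glauber.

(** * The Gibbs weight of nearly balanced configurations *)

(** The derivative of [f] has the sign of [z] for [|z| <= eps], so [f] is minimal at 0, where it
    vanishes. This bounds the density of a biased spin relative to a fair one. *)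
Lemma ge1D_expR_quad (R : realType) (eps y : R) : 0 < eps <= 2^-1 -> `|y| <= eps ->
  1 + y <= expR (y - (1 - eps) / 2 * y ^+ 2).
Proof.
move=> /andP[eps0 eps2]; rewrite ler_norml => /andP[y1 y2].
pose f (z : R) := z - (1 - eps) / 2 * z ^+ 2 - ln (1 + z).
have df (z : R) : -1 < z -> is_derive z (1 : R) f (z * (eps - (1 - eps) * z) / (1 + z)).
  move=> z1; have h : 0 < 1 + z by lra.
  have dl : is_derive z (1 : R) (fun u : R => ln (1 + u)) (1 + z)^-1.
    have := @is_derive1_comp R (@ln R) (fun u : R => 1 + u) z (1 + z)^-1 1.
    rewrite mulr1; apply; first exact: is_derive1_ln.
    by rewrite -[X in is_derive _ _ _ X]add0r; apply: is_deriveD.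
  apply: is_derive_eq.
  by rewrite /GRing.scale /= !mulr1; field; rewrite gt_eqF.
have f0 : f 0 = 0 by rewrite /f expr0n mulr0 addr0 ln1; ring.
suff : 0 <= f y.
  rewrite /f subr_ge0 => h; rewrite -[1 + y]lnK ?ler_expR // posrE; lra.
rewrite -f0.
have cont (a b : R) : -1 < a -> {within `[a, b], continuous f}%classic.
  move=> a1; apply: derivable_within_continuous => z; rewrite in_itv /= => /andP[az _].
  by have [] := df z (lt_le_trans a1 az).
case: (leP 0 y) => y0.
  refine (@ger0_derive1_le_cc R f 0 y _ _ _ 0 y _ _ y0).
  - by move=> z; rewrite in_itv /= => /andP[z0 _]; have [] := df z (lt_trans (ltrN10 R) z0).
  - move=> z; rewrite in_itv /= => /andP[z0 zy].
    rewrite derive1E; have [_ ->] := df z (lt_trans (ltrN10 R) z0).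
    have ez : 0 <= eps * z by rewrite mulr_ge0 ?ltW.
    by apply: divr_ge0; [apply: mulr_ge0; lra | lra].
  - by apply: cont; lra.
  - by rewrite in_itv /= lexx y0.
  - by rewrite in_itv /= lexx y0.
refine (@ler0_derive1_le_cc R f y 0 _ _ _ 0 y _ _ (ltW y0)).
- by move=> z; rewrite in_itv /= => /andP[z0 _]; have [] := df z ltac:(lra).
- move=> z; rewrite in_itv /= => /andP[z0 zy].
  rewrite derive1E; have [_ ->] := df z ltac:(lra).
  have ez : (1 - eps) * z <= 0 by rewrite mulr_ge0_le0 //; lra.
  by apply: mulr_le0_ge0; [apply: mulr_le0_ge0; lra | rewrite invr_ge0; lra].
- by apply: cont; lra.
- by rewrite in_itv /= lexx ltW.
- by rewrite in_itv /= lexx ltW.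
Qed.

(** * Independent spins with prescribed means *)

Section ProductMeasure.
Variables (R : realType) (n : nat) (x : 'I_n -> R).

Definition prod_weight (s : config n) : R := \prod_v ((1 + spin R (s v) * x v) / 2).

(** The sum factors over vertices. Sets of 0, 1 and 2 vertices give the total mass, the means and
    the pair correlations. *)
Lemma prod_weight_spins (A : {set 'I_n}) :
  \sum_s prod_weight s * \prod_(v in A) spin R (s v) = \prod_(v in A) x v.
Proof.
pose F v b := (1 + spin R b * x v) / 2 * (if v \in A then spin R b else 1).
have -> : \sum_s prod_weight s * \prod_(v in A) spin R (s v) =
    \sum_(s : config n) \prod_v F v (s v).
  by apply: eq_bigr => s _; rewrite [X in _ * X]big_mkcond -big_split.
rewrite -(bigA_distr_bigA F) [RHS]big_mkcond; apply: eq_bigr => v _.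
by rewrite big_bool /F /spin /=; case: ifP => _; field.
Qed.

Lemma prod_weight_sum1 : \sum_s prod_weight s = 1.
Proof.
have := prod_weight_spins set0; rewrite big_set0 => <-.
by apply: eq_bigr => s _; rewrite big_set0 mulr1.
Qed.

Lemma prod_weight_spin v : \sum_s prod_weight s * spin R (s v) = x v.
Proof.
have := prod_weight_spins [set v]; rewrite big_set1 => <-.
by apply: eq_bigr => s _; rewrite big_set1.
Qed.

Lemma prod_weight_spin2 v w : v != w ->
  \sum_s prod_weight s * (spin R (s v) * spin R (s w)) = x v * x w.
Proof.
move=> vw; have := prod_weight_spins [set v; w].
rewrite big_setU1 ?inE //= big_set1 => <-.
by apply: eq_bigr => s _; rewrite big_setU1 ?inE //= big_set1.
Qed.

End ProductMeasure.

(** * Bounds on the partition function and on the energy *)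

Section FreeEnergy.
Variables (R : realType) (m : nat) (k : 'I_m -> 'I_m -> R).
Variables (n : nat) (g : 'I_n -> 'I_m) (beta : R).
Hypothesis k_sym : forall i j, k i j = k j i.

Definition pair_energy (x : 'I_n -> R) : R :=
  \sum_(v : 'I_n) \sum_(w : 'I_n | (v < w)%N) Kint k g v w * x v * x w.

(** Jensen's inequality for the product measure of means [x]; the quadratic term bounds its relative
    entropy with respect to fair spins. *)
Lemma partition_fn_ge (x : 'I_n -> R) (eps : R) :
  0 < eps <= 2^-1 -> (forall v, `|x v| <= eps) ->
  2 ^+ n * expR (beta * pair_energy x - (1 + eps) / 2 * \sum_v x v ^+ 2) <=
  partition_fn k g beta.
Proof.
move=> heps hx; have /andP[eps0 eps2] := heps.
set u0 := beta * _ - _.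
(* The subtracted sum bounds the logarithm of [2 ^+ n * prod_weight x s] from above, and [U] has
   mean [u0]. *)
pose U (s : config n) := beta * energy k g s -
  \sum_v (spin R (s v) * x v - (1 - eps) / 2 * x v ^+ 2).
have EU : \sum_s prod_weight x s * U s = u0.
  have E1 : \sum_s prod_weight x s * energy k g s = pair_energy x.
    under eq_bigr => s _ do rewrite mulr_sumr.
    rewrite exchange_big /=; apply: eq_bigr => v _.
    under eq_bigr => s _ do rewrite mulr_sumr.
    rewrite exchange_big /=; apply: eq_bigr => w vw.
    rewrite -mulrA -(prod_weight_spin2 x); last by rewrite neq_ltn vw.
    by rewrite mulr_sumr; apply: eq_bigr => s _; ring.
  have E2 : \sum_s prod_weight x s *
      (\sum_v (spin R (s v) * x v - (1 - eps) / 2 * x v ^+ 2)) =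
      (1 + eps) / 2 * \sum_v x v ^+ 2.
    under eq_bigr => s _ do rewrite mulr_sumr.
    rewrite exchange_big mulr_sumr /=; apply: eq_bigr => v _.
    rewrite (eq_bigr (fun s => prod_weight x s * spin R (s v) * x v -
      prod_weight x s * ((1 - eps) / 2 * x v ^+ 2))); last by move=> s _; ring.
    rewrite sumrB -!mulr_suml prod_weight_spin prod_weight_sum1.
    by field.
  rewrite /u0 -E1 -E2 mulr_sumr -sumrB; apply: eq_bigr => s _.
  by rewrite /U; ring.
have spin_norm b v : `|spin R b * x v| <= eps.
  by rewrite normrM /spin; case: b; rewrite ?normrN normr1 mul1r.
have w_ge0 s : 0 <= prod_weight x s.
  apply: prodr_ge0 => v _; have := spin_norm (s v) v.
  by rewrite ler_norml => /andP[]; lra.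
have dens s : 2 ^+ n * (prod_weight x s * expR (U s)) <= expR (beta * energy k g s).
  rewrite mulrA /prod_weight (_ : 2 ^+ n = \prod_(v : 'I_n) 2); last first.
    by rewrite prodr_const card_ord.
  rewrite -big_split /= /U; set S := \sum_v _.
  rewrite -[X in _ <= expR X](subrK S) [X in _ <= expR X]addrC [in leRHS]expRD.
  rewrite ler_wpM2r ?expR_ge0 // /S expR_sum; apply: ler_prod => v _.
  rewrite mulrCA mulfV ?pnatr_eq0 // mulr1; apply/andP; split.
    by have := spin_norm (s v) v; rewrite ler_norml => /andP[]; lra.
  have -> : x v ^+ 2 = (spin R (s v) * x v) ^+ 2.
    by rewrite /spin; case: (s v); ring.
  exact: ge1D_expR_quad.
apply: le_trans (ler_sum _ (fun s _ => dens s)).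
rewrite -mulr_sumr ler_wpM2l ?exprn_ge0 //.
(* Jensen through the tangent line of the exponential at [u0]. *)
have -> : expR u0 = \sum_s prod_weight x s * (expR u0 * (1 + (U s - u0))).
  rewrite (eq_bigr (fun s => expR u0 * (1 - u0) * prod_weight x s +
    expR u0 * (prod_weight x s * U s))); last by move=> s _; ring.
  by rewrite big_split /= -!mulr_sumr prod_weight_sum1 EU; ring.
apply: ler_sum => s _; rewrite ler_wpM2l //.
have -> : expR (U s) = expR u0 * expR (U s - u0) by rewrite -expRD addrC subrK.
by rewrite ler_wpM2l ?expR_ge0 ?expR_ge1Dx.
Qed.

Definition block_sum (x : 'I_n -> R) (i : 'I_m) : R := \sum_(v | g v == i) x v.

(** Couplings depend only on blocks, so adding the diagonal completes a quadratic form in the block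
    sums. Real [x] covers both spins and trial means. *)
Lemma pair_energyE (x : 'I_n -> R) : pair_energy x = (2 * n%:R)^-1 *
  (\sum_i \sum_j k i j * block_sum x i * block_sum x j -
   \sum_v k (g v) (g v) * x v ^+ 2).
Proof.
rewrite /pair_energy sum_pairs; last by move=> v w; rewrite /Kint k_sym.
rewrite invfM -mulrA; congr (_ * _).
have -> : \sum_i \sum_j k i j * block_sum x i * block_sum x j =
    \sum_v \sum_w k (g v) (g w) * x v * x w.
  rewrite [RHS](partition_big g xpredT) //=; apply: eq_bigr => i _.
  under eq_bigr => j _ do rewrite mulrAC mulr_sumr.
  rewrite exchange_big /=; apply: eq_bigr => v /eqP gv.
  rewrite [RHS](partition_big g xpredT) //=; apply: eq_bigr => j _.
  rewrite gv mulrAC mulr_sumr; apply: eq_bigr => w /eqP ->.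
  by ring.
rewrite -sumrB mulr_sumr; apply: eq_bigr => v _.
have -> : \sum_w k (g v) (g w) * x v * x w - k (g v) (g v) * x v ^+ 2 =
    \sum_(w | w != v) k (g v) (g w) * x v * x w by rewrite (bigD1 v) //=; ring.
by rewrite mulr_sumr; apply: eq_bigr => w _; rewrite /Kint; ring.
Qed.

Let bs (s : config n) i := block_sum (fun v => spin R (s v)) i.

Lemma energyE s : energy k g s = (2 * n%:R)^-1 *
  (\sum_i \sum_j k i j * bs s i * bs s j - \sum_v k (g v) (g v)).
Proof.
rewrite -[energy k g s]/(pair_energy (fun v => spin R (s v))) pair_energyE.
congr (_ * (_ - _)); apply: eq_bigr => v _.
by rewrite /spin; case: (s v); rewrite ?sqrrN expr1n mulr1.
Qed.

Lemma magn_block s : magn R s = \sum_i bs s i.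
Proof. by rewrite /magn (partition_big g xpredT). Qed.

Definition block_sign s : {ffun 'I_m -> bool} := [ffun i => bs s i < 0].

Lemma block_sum_flip s i : bs (flip g (block_sign s) s) i = `|bs s i|.
Proof.
have e : bs (flip g (block_sign s) s) i = (if bs s i < 0 then -1 else 1) * bs s i.
  rewrite [X in _ * X]/bs {1}/bs /block_sum mulr_sumr; apply: eq_bigr => v /eqP gv.
  by rewrite !ffunE gv /spin; case: (bs s i < 0); case: (s v) => /=; ring.
by rewrite e; case: (ltP (bs s i) 0) => h; [rewrite mulN1r ltr0_norm | rewrite mul1r ger0_norm].
Qed.

Variables (kmin kmax : R).
Hypothesis k_ge : forall i j, kmin <= k i j.
Hypothesis k_le : forall i j, k i j <= kmax.
Hypothesis kmin_ge0 : 0 <= kmin.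
Hypothesis kmax_ge0 : 0 <= kmax.
Hypothesis beta_ge0 : 0 <= beta.

Lemma energy_block_le s :
  energy k g s <= (2 * n%:R)^-1 * (kmax * (\sum_i `|bs s i|) ^+ 2).
Proof.
rewrite energyE ler_wpM2l ?invr_ge0 ?mulr_ge0 //.
apply: (@le_trans _ _ (\sum_i \sum_j k i j * bs s i * bs s j)).
  rewrite gerBl; apply: sumr_ge0 => v _; exact: le_trans (k_ge _ _).
rewrite expr2 mulr_suml mulr_sumr; apply: ler_sum => i _.
rewrite mulr_sumr mulr_sumr; apply: ler_sum => j _.
rewrite -mulrA -normrM; apply: (@le_trans _ _ (k i j * `|bs s i * bs s j|)).
  by rewrite ler_wpM2l ?ler_norm // (le_trans kmin_ge0).
by rewrite ler_wpM2r.
Qed.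

(** The diagonal cancels, and each remaining term [|M_i| |M_j| - M_i M_j] is nonnegative, so [k i j]
    may be replaced by [kmin]. *)
Lemma energy_flip_ge s : (2 * n%:R)^-1 * (kmin * ((\sum_i `|bs s i|) ^+ 2 - magn R s ^+ 2))
  <= energy k g (flip g (block_sign s) s) - energy k g s.
Proof.
rewrite !energyE -mulrBr ler_wpM2l ?invr_ge0 ?mulr_ge0 //.
rewrite opprB addrA subrK magn_block.
under [X in _ <= X - _]eq_bigr => i _ do under eq_bigr => j _ do rewrite !block_sum_flip.
rewrite !expr2 !mulr_suml -sumrB mulr_sumr -sumrB; apply: ler_sum => i _.
rewrite !mulr_sumr -sumrB mulr_sumr -sumrB; apply: ler_sum => j _.
rewrite -!mulrA -mulrBr ler_wpM2r //.
by rewrite subr_ge0 -normrM ler_norm.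
Qed.

(** The threshold [d] separates the two cases: the first term pays for aligning the blocks, with 4
    bounding [magn ^+ 2], and the second counts at most [2 ^+ n] configurations of low energy. *)
Lemma near_equator_weight (d : R) : 
  \sum_(s | `|magn R s| <= 2) expR (beta * energy k g s) <=
  2 ^+ m * expR (- (beta * (2 * n%:R)^-1 * (kmin * (d * n%:R ^+ 2 - 4))))
    * partition_fn k g beta
  + 2 ^+ n * expR (beta * (2 * n%:R)^-1 * (kmax * (d * n%:R ^+ 2))).
Proof.
pose N1 s := (\sum_i `|bs s i|) ^+ 2.
rewrite (bigID (fun s => d * n%:R ^+ 2 <= N1 s)) /=; apply: lerD; last first.
  rewrite (_ : 2 ^+ n = \sum_(s : config n) 1); last first.
    by rewrite sumr_const card_ffun card_bool card_ord natrX.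
  rewrite mulr_suml [leLHS]big_mkcond /=; apply: ler_sum => s _.
  rewrite mul1r; case: ifP => [/andP[_]|_]; last exact: expR_ge0.
  rewrite -ltNge => /ltW h; rewrite ler_expR -!mulrA ler_wpM2l //.
  apply: le_trans (energy_block_le s) _.
  by rewrite ler_wpM2l ?invr_ge0 ?mulr_ge0 // ler_wpM2l.
set c := beta * _ * _.
(* Every block flip is a bijection of configurations, so summing over all [2 ^+ m] of them replaces
   counting the fibres of the aligning map. *)
have -> : 2 ^+ m * expR (- c) * partition_fn k g beta =
  \sum_(s : config n) expR (- c) * \sum_(e : {ffun 'I_m -> bool}) expR (beta * energy k g (flip g e s)).
  rewrite -mulr_sumr exchange_big /= (eq_bigr (fun=> partition_fn k g beta)).
    by rewrite sumr_const card_ffun card_bool card_ord -[_ *+ (2 ^ m)]mulr_natl natrX; ring.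
  by move=> e _; rewrite /partition_fn [RHS](reindex_inj (inv_inj (flipK g e))).
rewrite big_mkcond /=; apply: ler_sum => s _; case: ifP => [/andP[ms Ns]|_]; last first.
  by rewrite mulr_ge0 ?expR_ge0 // sumr_ge0 // => e _; rewrite expR_ge0.
rewrite expRN ler_pdivlMl ?expR_gt0 //.
apply: (@le_trans _ _ (expR (beta * energy k g (flip g (block_sign s) s)))); last first.
  by rewrite (bigD1 (block_sign s)) //= lerDl sumr_ge0 // => e _; rewrite expR_ge0.
rewrite -expRD ler_expR -lerBrDr -mulrBr /c -mulrA ler_wpM2l //.
apply: le_trans (energy_flip_ge s).
rewrite ler_wpM2l ?invr_ge0 ?mulr_ge0 // ler_wpM2l //.
apply: lerB => //; rewrite -real_normK ?num_real //.
by have := normr_ge0 (magn R s); nra.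
Qed.

End FreeEnergy.

Lemma sumr_gt0 (R : realType) (I : finType) (F : I -> R) (i0 : I) :
  (forall i, 0 < F i) -> 0 < \sum_i F i.
Proof.
move=> F0; rewrite (bigD1 i0) //= ltr_wpDr //.
by apply: sumr_ge0 => i _; exact: ltW.
Qed.

(** * Block-constant trial means built from the Perron vector *)

Section PerronTrial.
Variables (R : realType) (m : nat) (p : 'I_m -> R) (k : 'I_m -> 'I_m -> R).
Variables (n : nat) (g : 'I_n -> 'I_m).
Hypothesis g_card : forall i, (#|[set v | g v == i]|)%:R = n%:R * p i.

Lemma block_sum_const (b : 'I_m -> R) i :
  block_sum g (fun v => b (g v)) i = n%:R * (p i * b i).
Proof.
rewrite /block_sum (eq_bigr (fun=> b i)); last by move=> v /eqP ->.
rewrite sumr_const -[_ *+ _]mulr_natl (_ : #|_| = #|[set v | g v == i]|).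
  by rewrite g_card mulrA.
by apply: eq_card => v; rewrite inE.
Qed.

Lemma sum_block_const (b : 'I_m -> R) :
  \sum_v b (g v) = n%:R * \sum_i p i * b i.
Proof.
rewrite (partition_big g xpredT) //= mulr_sumr; apply: eq_bigr => i _.
exact: block_sum_const.
Qed.

(** Summing over [i] first gives the left eigenvector equation, and the weight [p j * a j]
    remains. *)
Lemma sum_pairs_perron (a : 'I_m -> R) (lam eta : R) :
  (forall j, \sum_i a i * (p i * k i j) = lam * a j) ->
  \sum_i \sum_j k i j * block_sum g (fun v => eta * a (g v)) i
                      * block_sum g (fun v => eta * a (g v)) j =
  n%:R ^+ 2 * eta ^+ 2 * (lam * \sum_i p i * a i ^+ 2).
Proof.
move=> perron; rewrite exchange_big /= mulr_sumr mulr_sumr; apply: eq_bigr => j _.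
rewrite (eq_bigr (fun i => (n%:R ^+ 2 * eta ^+ 2 * p j * a j) * (a i * (p i * k i j)))).
  by rewrite -mulr_sumr perron; ring.
move=> i _; rewrite !(block_sum_const (fun i => eta * a i)); ring.
Qed.

End PerronTrial.

(** * Exponentially small weight near zero magnetisation, and the mixing time *)

Lemma gibbs_near_equator (R : realType) (m : nat) (p : 'I_m -> R)
    (k : 'I_m -> 'I_m -> R) (a : 'I_m -> R) (beta : R) :
  (0 < m)%N -> (forall i, 0 < p i) -> \sum_i p i = 1 ->
  (forall i j, 0 < k i j) -> (forall i j, k i j = k j i) ->
  is_left_perron p k a -> beta_cr p k a < beta ->
  exists c : R, 0 < c /\ exists N : nat, forall (n : nat) (g : 'I_n -> 'I_m),
    (N <= n)%N -> (forall i, (#|[set v | g v == i]|)%:R = n%:R * p i) ->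
    \sum_(s | `|magn R s| <= 2) gibbs k g beta s <= expR (- (c * n%:R)) / 16.
Proof.
move=> m0 p0 p1 k0 k_sym [a0 [a1 [lam perron]]] hbeta.
pose i0 := Ordinal m0.
have lam_gt0 : 0 < lam.
  rewrite -(pmulr_lgt0 _ (a0 i0)) -perron.
  by apply: (sumr_gt0 i0) => i; rewrite !mulr_gt0.
have bl : 1 < beta * lam.
  rewrite -ltr_pdivrMr // div1r; apply: le_lt_trans hbeta.
  rewrite /beta_cr exchange_big /= (eq_bigr (fun j => lam * a j)).
    by rewrite -mulr_sumr a1 mulr1.
  by move=> j _; rewrite -perron; apply: eq_bigr => i _; rewrite mulrA.
have beta0 : 0 < beta.
  by rewrite -(pmulr_lgt0 _ lam_gt0) (lt_trans _ bl).
pose kmin := \big[Num.min/1]_(x : 'I_m * 'I_m) k x.1 x.2.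
have kmin0 : 0 < kmin by apply: lt_bigmin => // x _.
have k_ge i j : kmin <= k i j by apply: (bigmin_le_cond _ (j := (i, j))).
pose kmax := \sum_i \sum_j k i j.
have k_le i j : k i j <= kmax.
  rewrite /kmax (bigD1 i) //= (bigD1 j) //= -addrA lerDl addr_ge0 //.
    by apply: sumr_ge0 => l _; exact: ltW.
  by apply: sumr_ge0 => l _; apply: sumr_ge0 => l' _; exact: ltW.
have kmax0 : 0 < kmax by apply: lt_le_trans (k_le i0 i0).
have a_le1 i : a i <= 1.
  by rewrite -a1 (bigD1 i) //= lerDl sumr_ge0 // => j _; exact: ltW.
(* The first bound is required by [ge1D_expR_quad]; the second keeps [beta * lam - 1 - eps], hence
   [c1], positive. *)
pose eps := Num.min 2^-1 ((beta * lam - 1) / 2).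
have eps0 : 0 < eps by rewrite lt_min; apply/andP; split; lra.
have eps2 : eps <= 2^-1 by rewrite ge_min lexx.
have epsbl : eps <= (beta * lam - 1) / 2 by rewrite ge_min lexx orbT.
pose S2 := \sum_i p i * a i ^+ 2.
have S2_gt0 : 0 < S2 by apply: (sumr_gt0 i0) => i; rewrite mulr_gt0 ?exprn_gt0.
pose c1 := eps ^+ 2 / 2 * S2 * (beta * lam - 1 - eps).
have c1_gt0 : 0 < c1 by rewrite !mulr_gt0 ?exprn_gt0 ?invr_gt0 //; lra.
pose C1 := beta / 2 * kmax * eps ^+ 2.
(* With this [d] the low-energy configurations have exponent at most [c1 / 2 * n], half the growth
   rate [c1] of the bound on [Z]. *)
pose d := c1 / (beta * kmax).
have d_gt0 : 0 < d by apply: divr_gt0 => //; apply: mulr_gt0.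
pose C2 := 2 * beta * kmin.
(* Both contributions decay at rate at least [2 * c]; one half of it absorbs the constant
   [16 * B]. *)
pose c := Num.min (beta * kmin * d / 2) (c1 / 2) / 2.
have c_gt0 : 0 < c.
  have bkd : 0 < beta * kmin * d by do 2![apply: mulr_gt0 => //].
  by rewrite divr_gt0 // lt_min; apply/andP; split; lra.
have c_le1 : 2 * c <= beta * kmin * d / 2.
  by rewrite /c mulrC divfK ?pnatr_eq0 // ge_min lexx.
have c_le2 : 2 * c <= c1 / 2.
  by rewrite /c mulrC divfK ?pnatr_eq0 // ge_min lexx orbT.
pose B := 2 ^+ m * expR C2 + expR C1.
have B_ge0 : 0 <= B by rewrite addr_ge0 ?mulr_ge0 ?exprn_ge0 ?expR_ge0.
(* Beyond this threshold [16 * B <= c * n <= expR (c * n)]; the successor ensures [n > 0]. *)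
exists c; split=> //; exists (Num.bound (16 * B / c)).+1 => n g Nn g_card.
have n_gt0 : (0 < n)%N by apply: leq_trans Nn.
have n0 : 0 < n%:R :> R by rewrite ltr0n.
have n1 : 1 <= n%:R :> R by rewrite ler1n.
have nB : 16 * B <= c * n%:R.
  rewrite [leRHS]mulrC -ler_pdivrMr //.
  have /archi_boundP/ltW h : 0 <= 16 * B / c.
    by apply: divr_ge0; [apply: mulr_ge0 | exact: ltW].
  by apply: (le_trans h); rewrite ler_nat ltnW.
set Z := partition_fn k g beta.
have Z_gt0 : 0 < Z by exact: partition_fn_gt0.
pose x v := eps * a (g v).
have x_le v : `|x v| <= eps.
  have ea := ltW eps0; have av := ltW (a0 (g v)).
  by rewrite /x ger0_norm ?mulr_ge0 // ler_piMr.
have sumx2 : \sum_v x v ^+ 2 = n%:R * (eps ^+ 2 * S2).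
  rewrite (sum_block_const g_card (fun i => (eps * a i) ^+ 2)) /S2 [eps ^+ 2 * _]mulr_sumr.
  by congr (_ * _); apply: eq_bigr => i _; ring.
have diag : \sum_v k (g v) (g v) * x v ^+ 2 <= n%:R * (kmax * eps ^+ 2).
  rewrite [leRHS]mulr_natl -[X in _ <= _ *+ X]card_ord -sumr_const.
  apply: ler_sum => v _; apply: ler_pM; rewrite ?sqr_ge0 ?k_le //; first exact: ltW.
  by rewrite -[x v ^+ 2]ger0_norm ?sqr_ge0 // normrX lerXn2r ?nnegrE ?x_le // ltW.
pose L := beta * pair_energy k g x - (1 + eps) / 2 * \sum_v x v ^+ 2.
have LZ : 2 ^+ n * expR L <= Z.
  by apply: partition_fn_ge => //; rewrite eps0 eps2.
have L_ge : c1 * n%:R - C1 <= L.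
  rewrite /L pair_energyE // sumx2 (sum_pairs_perron g_card eps perron) -/S2.
  set D := \sum_v k _ _ * _ in diag *.
  have -> : beta * ((2 * n%:R)^-1 * (n%:R ^+ 2 * eps ^+ 2 * (lam * S2) - D)) -
      (1 + eps) / 2 * (n%:R * (eps ^+ 2 * S2)) =
      c1 * n%:R - beta / 2 * (D / n%:R).
    by rewrite /c1; field; rewrite gt_eqF.
  have b_ge0 := ltW beta0.
  rewrite lerD2l lerN2 /C1 -[leRHS]mulrA ler_wpM2l ?divr_ge0 //.
  by rewrite ler_pdivrMr // mulrC.
have := near_equator_weight g k_sym k_ge k_le (ltW kmin0) (ltW kmax0) (ltW beta0) d.
rewrite -/Z; set W := \sum_(s | _) _ => hW.
have -> : \sum_(s | `|magn R s| <= 2) gibbs k g beta s = W / Z by rewrite /W mulr_suml.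
have e1 : expR (- (beta * (2 * n%:R)^-1 * (kmin * (d * n%:R ^+ 2 - 4)))) <=
    expR C2 * expR (- (2 * c * n%:R)).
  rewrite -expRD ler_expR.
  have -> : beta * (2 * n%:R)^-1 * (kmin * (d * n%:R ^+ 2 - 4)) =
    beta * kmin * d / 2 * n%:R - C2 / n%:R by rewrite /C2; field; rewrite gt_eqF.
  have h1 : 2 * c * n%:R <= beta * kmin * d / 2 * n%:R by rewrite ler_wpM2r // ltW.
  have h2 : C2 / n%:R <= C2.
    by rewrite ler_pdivrMr // ler_peMr // !mulr_ge0 // ltW.
  lra.
have e2 : 2 ^+ n * expR (beta * (2 * n%:R)^-1 * (kmax * (d * n%:R ^+ 2))) <=
    expR C1 * expR (- (2 * c * n%:R)) * Z.
  have -> : beta * (2 * n%:R)^-1 * (kmax * (d * n%:R ^+ 2)) = c1 / 2 * n%:R.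
    by rewrite /d; field; rewrite !gt_eqF.
  apply: le_trans (ler_wpM2l _ LZ); last by rewrite mulr_ge0 ?expR_ge0.
  rewrite mulrCA ler_wpM2l ?exprn_ge0 // -!expRD ler_expR.
  have h1 : 2 * c * n%:R <= c1 / 2 * n%:R by rewrite ler_wpM2r // ltW.
  lra.
have hWB : W / Z <= B * expR (- (2 * c * n%:R)).
  rewrite ler_pdivrMr //; apply: le_trans hW _.
  set e := expR (- (2 * c * n%:R)) in e1 e2 *.
  have -> : B * e * Z = 2 ^+ m * (expR C2 * e) * Z + expR C1 * e * Z by rewrite /B; ring.
  apply: lerD => //; apply: ler_wpM2r; first exact: ltW.
  by apply: ler_wpM2l => //; exact: exprn_ge0.
apply: le_trans hWB _.
have -> : - (2 * c * n%:R) = - (c * n%:R) + - (c * n%:R) by ring.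
rewrite expRD mulrA [leRHS]mulrC ler_wpM2r ?expR_ge0 //.
rewrite expRN ler_pdivrMr ?expR_gt0 //.
have := expR_ge1Dx (c * n%:R); lra.
Qed.

Theorem theorem3p5 (R : realType) (m : nat) (p : 'I_m -> R)
    (k : 'I_m -> 'I_m -> R) (a : 'I_m -> R) (beta : R) :
  (0 < m)%N ->
  (forall i, 0 < p i) -> \sum_i p i = 1 ->
  (forall i j, 0 < k i j) -> (forall i j, k i j = k j i) ->
  is_left_perron p k a ->
  beta_cr p k a < beta ->
  exists c : R, 0 < c /\
    exists N : nat, forall (n : nat) (g : 'I_n -> 'I_m),
      (N <= n)%N ->
      (forall i, (#|[set v | g v == i]|)%:R = n%:R * p i) ->
      expR (c * n%:R) <= (tmix k g beta)%:R.
Proof.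
move=> m0 p0 p1 k0 k_sym perron hbeta.
have [c [c0 [N HN]]] := gibbs_near_equator m0 p0 p1 k0 k_sym perron hbeta.
exists c; split=> //; exists N.+1 => n g Nn g_card.
have n0 : (0 < n)%N by apply: leq_trans Nn.
have small := HN n g (ltnW Nn) g_card.
have le1 : expR (- (c * n%:R)) <= 1 by rewrite expR_le1 oppr_le0 mulr_ge0 // ltW.
have half : expR (- (c * n%:R)) / 16 <= 2^-1 by lra.
(* The factor 1/16 in [small] cancels the one in [tmix_bottleneck], so the rate [c] is kept. *)
have := tmix_bottleneck k_sym n0 (le_trans small half).
move=> /le_trans /(_ (ler_wpM2l (ler0n _ _) small)) h.
have : 1 <= (tmix k g beta)%:R * expR (- (c * n%:R)) by lra.
by rewrite expRN ler_pdivlMr ?expR_gt0 // mul1r.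
Qed.
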